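(* Let $S$ be a Hausdorff pseudocompact semitopological semigroup which is algebraically a primitive inverse semigroup, $S=\sum_{i\in\mathscr I}B_{\lambda_i}(G_i)$. Suppose that for every $i\in\mathscr I$ there is $\alpha_i\in\lambda_i$ such that the maximal subgroup $(G_i)_{\alpha_i,\alpha_i}$ (with the subspace topology) satisfies at least one of: (1) it is left precompact; (2) it is a pseudocompact paratopological group; (3) it is left $\omega$-precompact and pseudocompact; (4) the subsemigroup $(G_i)_{\alpha_i,\alpha_i}\cup\{0\}$ is a topological semigroup. Then: (i) every non-zero maximal subgroup of $S$ is an open-and-closed subset of $S$ and hence is pseudocompact; (ii) for every $i\in\mathscr I$ the subspace $B_{\lambda_i}(G_i)$ is pseudocompact, all subspaces $(G_i)_{\alpha,\beta}$, $\alpha,\beta\in\lambda_i$, are homeomorphic, and all $(G_i)_{\alpha,\alpha}$ are topologically isomorphic pseudocompact semitopological groups; (iii) if $\mathscr B$ is a base of the topology of $S$ at the unit $(\alpha_i,e_i,\alpha_i)$ of $(G_i)_{\alpha_i,\alpha_i}$ with $U\subseteq(G_i)_{\alpha_i,\alpha_i}$ for all $U\in\mathscr B$, then for all $\beta_i,\gamma_i\in\lambda_i$ and $x\in G_i$ the family $\{(\beta_i,x,\alpha_i)\cdot U\cdot(\alpha_i,e_i,\gamma_i):U\in\mathscr B\}$ is a base of the topology at $(\beta_i,x,\gamma_i)$; (iv) if moreover $S$ is semiregular, then the family of all sets $S\setminus\big((G_{i_1})_{\alpha_1,\beta_1}\cup\dots\cup(G_{i_k})_{\alpha_k,\beta_k}\big)$,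 where $k\in\mathbb N$, $i_1,\dots,i_k\in\mathscr I$, $\alpha_j,\beta_j\in\lambda_{i_j}$, is a base of the topology of $S$ at zero.
   Context: All spaces are Hausdorff; a semitopological (topological) semigroup is a Hausdorff space with a separately (jointly) continuous associative operation; a semitopological group (paratopological group) is a group with Hausdorff topology and separately (jointly) continuous multiplication. Pseudocompact: every locally finite family of non-empty open sets is finite. Semiregular: having a base of regular open sets ($\operatorname{int}\operatorname{cl}A=A$). For a group $G$ and cardinal $\lambda\ge1$, $B_\lambda(G)=(\lambda\times G\times\lambda)\cup\{0\}$ with $(\alpha,a,\beta)(\gamma,b,\delta)=(\alpha,ab,\delta)$ if $\beta=\gamma$ and $0$ otherwise. The orthogonal sum of semigroups $T_\iota$ with zeros is $\{0\}\cup\bigcup_\iota(T_\iota\setminus\{0_\iota\})$ with products computed in $T_\iota$ when both factors lie in the same $T_\iota$ and the product is non-zero, and $0$ otherwise. Primitive inverse semigroups are exactly orthogonal sums $\sum_{i\in\mathscr I}B_{\lambda_i}(G_i)$; we identify $B_{\lambda_i}(G_i)$ with a subsemigroup of $S$, write $(G_i)_{\alpha,\beta}=\{(\alpha,g,\beta):g\in G_i\}$ and $e_i$ for the unit of $G_i$; the maximal subgroups of $S$ are $\{0\}$ and the $(G_i)_{\alpha,\alpha}$. Left (resp. left $\omega$-) precompact: for each neighbourhood $U$ of the unit there is a finite (resp. countable) $F$ with $FU=G$. *)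

(* Defs.v *)
From Stdlib Require Import List Classical ClassicalEpsilon.
Set Implicit Arguments.

Record Grp := {
  gcar :> Type;
  gmul : gcar -> gcar -> gcar;
  gone : gcar;
  ginv : gcar -> gcar;
  gassoc : forall x y z, gmul x (gmul y z) = gmul (gmul x y) z;
  gone_l : forall x, gmul gone x = x;
  gone_r : forall x, gmul x gone = x;
  ginv_l : forall x, gmul (ginv x) x = gone;
  ginv_r : forall x, gmul x (ginv x) = gone }.

Record topology (X : Type) := {
  open : (X -> Prop) -> Prop;
  open_full : open (fun _ => True);
  open_inter : forall U V, open U -> open V -> open (fun x => U x /\ V x);
  open_union : forall F : (X -> Prop) -> Prop,
      (forall U, F U -> open U) -> open (fun x => exists U, F U /\ U x) }.

Section Topo.
Variable X : Type.
Variable T : topology X.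

Definition hausdorff : Prop :=
  forall x y : X, x <> y -> exists U V, open T U /\ open T V /\ U x /\ V y /\
      (forall z, U z -> V z -> False).

Definition closed (A : X -> Prop) : Prop := open T (fun x => ~ A x).
Definition clopen (A : X -> Prop) : Prop := open T A /\ closed A.

Definition continuous (f : X -> X) : Prop :=
  forall U, open T U -> open T (fun x => U (f x)).

Definition rel_open (A V : X -> Prop) : Prop :=
  (forall x, V x -> A x) /\
  exists O, open T O /\ forall x, A x -> (V x <-> O x).

Definition nbhd_in (A U : X -> Prop) (p : X) : Prop :=
  (forall x, U x -> A x) /\
  exists V, rel_open A V /\ V p /\ forall x, V x -> U x.

Definition locally_finite_in (A : X -> Prop) (F : (X -> Prop) -> Prop) : Prop :=
  forall x, A x -> exists W, rel_open A W /\ W x /\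
    exists l : list (X -> Prop),
      forall V, F V -> (exists y, V y /\ W y) -> In V l.

Definition pseudocompact_sub (A : X -> Prop) : Prop :=
  forall F : (X -> Prop) -> Prop,
    (forall V, F V -> rel_open A V /\ exists x, V x) ->
    locally_finite_in A F ->
    exists l : list (X -> Prop), forall V, F V -> In V l.

Definition rel_cont (A B : X -> Prop) (f : X -> X) : Prop :=
  (forall x, A x -> B (f x)) /\
  forall V, rel_open B V -> rel_open A (fun x => A x /\ V (f x)).

Definition homeomorphic_sub (A B : X -> Prop) : Prop :=
  exists f g : X -> X, rel_cont A B f /\ rel_cont B A g /\
    (forall x, A x -> g (f x) = x) /\ (forall y, B y -> f (g y) = y).

Definition base_at (Bf : (X -> Prop) -> Prop) (p : X) : Prop :=
  (forall U, Bf U -> open T U /\ U p) /\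
  (forall W, open T W -> W p -> exists U, Bf U /\ forall x, U x -> W x).

Definition interior (A : X -> Prop) (x : X) : Prop :=
  exists O, open T O /\ O x /\ forall y, O y -> A y.
Definition closure (A : X -> Prop) (x : X) : Prop :=
  forall O, open T O -> O x -> exists y, O y /\ A y.
Definition regular_open (U : X -> Prop) : Prop :=
  forall x, interior (closure U) x <-> U x.
Definition semiregular : Prop :=
  forall W x, open T W -> W x ->
    exists U, open T U /\ regular_open U /\ U x /\ forall y, U y -> W y.

Variable mul : X -> X -> X.

Definition semitop_semigroup : Prop :=
  hausdorff /\ forall a, continuous (fun x => mul a x) /\ continuous (fun x => mul x a).

Definition semitop_sub (A : X -> Prop) : Prop :=
  (forall x y, A x -> A y -> A (mul x y)) /\
  forall a, A a -> rel_cont A A (fun x => mul a x) /\ rel_cont A A (fun x => mul x a).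

Definition jointly_cont_sub (A : X -> Prop) : Prop :=
  (forall x y, A x -> A y -> A (mul x y)) /\
  forall x y, A x -> A y -> forall W, rel_open A W -> W (mul x y) ->
    exists U V, rel_open A U /\ rel_open A V /\ U x /\ V y /\
      forall u v, U u -> V v -> W (mul u v).

Definition top_iso_sub (A B : X -> Prop) : Prop :=
  exists f g : X -> X, rel_cont A B f /\ rel_cont B A g /\
    (forall x, A x -> g (f x) = x) /\ (forall y, B y -> f (g y) = y) /\
    (forall x y, A x -> A y -> f (mul x y) = mul (f x) (f y)).

Definition left_precompact_sub (H : X -> Prop) (e : X) : Prop :=
  forall U, nbhd_in H U e ->
    exists l : list X, (forall f, In f l -> H f) /\
      forall x, H x -> exists f u, In f l /\ U u /\ x = mul f u.

Definition left_omega_precompact_sub (H : X -> Prop) (e : X) : Prop :=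
  forall U, nbhd_in H U e ->
    exists f : nat -> X, (forall n, H (f n)) /\
      forall x, H x -> exists n u, U u /\ x = mul (f n) u.

End Topo.

Section Brandt.
Variable I : Type.
Variable L : I -> Type.   (* L i is the cardinal lambda_i (as a set) *)
Variable G : I -> Grp.

Definition cell (i : I) : Type := (L i * G i * L i)%type.

(* None is the zero; Some (i; (a,g,b)) is (a,g,b) in B_{lambda_i}(G_i) *)
Definition Bsum : Type := option {i : I & cell i}.

Definition decP (P : Prop) : {P} + {~ P} := excluded_middle_informative P.

Definition bmul (x y : Bsum) : Bsum :=
  match x, y with
  | Some (existT _ i (a, g, b)), Some (existT _ j t) =>
      match decP (j = i) with
      | left e =>
          match eq_rect j cell t i e with
          | (c, h, d) =>
              if decP (b = c) then Some (existT cell i (a, gmul (G i) g h, d))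
              else None
          end
      | right _ => None
      end
  | _, _ => None
  end.

Definition elt (i : I) (a : L i) (g : G i) (b : L i) : Bsum :=
  Some (existT cell i (a, g, b)).
Arguments elt : clear implicits.

Definition Hset (i : I) (a b : L i) (s : Bsum) : Prop :=
  exists g : G i, s = elt i a g b.
Arguments Hset : clear implicits.

Definition Bset (i : I) (s : Bsum) : Prop :=
  s = None \/ exists a g b, s = elt i a g b.

Definition setmul3 (a : Bsum) (U : Bsum -> Prop) (b : Bsum) (s : Bsum) : Prop :=
  exists u, U u /\ s = bmul (bmul a u) b.

Definition zero_family (V : Bsum -> Prop) : Prop :=
  exists l : list {i : I & (L i * L i)%type},
    forall s, V s <-> ~ (exists t, In t l /\
                           Hset (projT1 t) (fst (projT2 t)) (snd (projT2 t)) s).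

End Brandt.
Arguments elt {I L G} i a g b.
Arguments Hset {I L G} i a b s.
Arguments Bset {I L G} i s.
Arguments zero_family {I L G} V.

(* Main.v *)
(** Every cell [(G_i)_{a,b}] is open, being the set where the continuous map
    [s |-> (a,e,a) s (b,e,b)] is non-zero, and translations identify all cells of [B_i]; so all
    cells are clopen once zero is not in the closure of one subgroup [K = (G_i)_{a,a}].
    Suppose it is, and let [U] be a neighbourhood of the unit disjoint from a neighbourhood of zero.
    As translations fix zero, zero is not adherent to any finite union of translates of [U], which
    excludes precompactness; for [K] a countable union of translates [f_n U], points near zero
    avoiding [f_0 U, ..., f_n U] give open sets with no cluster point in [K].  Under joint
    continuity, feeble compactness puts inverses of points near the unit into the closure of [U], and
    this excludes a sequence of translates [x_n^-1 V] with [x_n x_m^-1] near zero for [m < n].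
    Pseudocompactness then passes to clopen sets and to the retracts [B_i]; at zero, regular
    openness makes all but finitely many cells lie inside a given neighbourhood. *)
Require Import Defs.
From Stdlib Require Import List Classical ClassicalEpsilon IndefiniteDescription PeanoNat
  FunctionalExtensionality PropExtensionality Lia.

(** * Cancellation and inversion identities in a group *)

Section GroupLemmas.
Variable K : Grp.
Local Notation "x * y" := (gmul K x y).
Local Notation "x ^-1" := (ginv K x) (at level 3, format "x ^-1").
Local Notation "1" := (gone K).

Lemma gmulVK (x y : K) : x^-1 * (x * y) = y.
Proof. now rewrite gassoc, ginv_l, gone_l. Qed.

Lemma gmulKV (x y : K) : x * (x^-1 * y) = y.
Proof. now rewrite gassoc, ginv_r, gone_l. Qed.

Lemma gmul_cancel_l (x y z : K) : x * y = x * z -> y = z.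
Proof. now intros E; rewrite <- (gmulVK x y), E, gmulVK. Qed.

Lemma ginv_mul (x y : K) : (x * y)^-1 = y^-1 * x^-1.
Proof.
apply (gmul_cancel_l (x * y)).
now rewrite ginv_r, <- gassoc, gmulKV, ginv_r.
Qed.

Lemma ginv_inv (x : K) : (x^-1)^-1 = x.
Proof. now apply (gmul_cancel_l x^-1); rewrite ginv_r, ginv_l. Qed.

Lemma ginv_one : 1^-1 = 1.
Proof. now rewrite <- (gone_l K 1^-1), ginv_r. Qed.

End GroupLemmas.

(** Dependent choice with memory: [h n] lists the earlier terms, so each new term can be chosen
    subject to conditions involving all of them. *)
Lemma history_sequence (A : Type) (P : list A -> A -> Prop) :
  (forall l, exists x, P l x) ->
  exists x : nat -> A, forall n, exists l,
    P l (x n) /\ forall m, m < n -> In (x m) l.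
Proof.
intros H.
destruct (functional_choice _ H) as [f Hf].
set (h := fix h n := match n with 0 => nil | S k => f (h k) :: h k end).
exists (fun n => f (h n)); intros n; exists (h n); split; [apply Hf|].
induction n as [|n IH]; intros m Hm; [lia|].
simpl; destruct (Nat.eq_dec m n) as [->|]; [now left|right; apply IH; lia].
Qed.

(** * Groups with continuous translations and the filter left on them by an outside zero *)

Section ZeroFilter.
Variable K : Grp.
Variable opn : (K -> Prop) -> Prop.
Local Notation "x * y" := (gmul K x y).
Local Notation "x ^-1" := (ginv K x) (at level 3, format "x ^-1").
Local Notation "1" := (gone K).

Hypothesis opn_inter : forall U V, opn U -> opn V -> opn (fun x => U x /\ V x).
Hypothesis opn_mull : forall g U, opn U -> opn (fun x => U (g * x)).
Hypothesis opn_mulr : forall g U, opn U -> opn (fun x => U (x * g)).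

Definition adherent (A : K -> Prop) (x : K) : Prop :=
  forall Q, opn Q -> Q x -> exists y, Q y /\ A y.

Definition frequently_meets (A : nat -> K -> Prop) (Q : K -> Prop) : Prop :=
  forall N, exists n, N <= n /\ exists x, A n x /\ Q x.

(** Existence of such a [p] for every sequence of non-empty open sets is the sequential form of
    pseudocompactness. *)
Definition clusters_at (A : nat -> K -> Prop) (p : K) : Prop :=
  forall Q, opn Q -> Q p -> frequently_meets A Q.

Definition nonempty_open_seq (A : nat -> K -> Prop) : Prop :=
  forall n, opn (A n) /\ exists x, A n x.

(** This is joint continuity of the multiplication at [(1, 1)]; continuous translations spread it to
    all pairs of points. *)
Definition square_root_nbhds : Prop :=
  forall U, opn U -> U 1 ->
    exists V, opn V /\ V 1 /\ forall x y, V x -> V y -> U (x * y).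

Lemma square_root_sequence (U : K -> Prop) :
  square_root_nbhds -> opn U -> U 1 ->
  exists u : nat -> K -> Prop,
    (forall x, u 0 x <-> U x) /\ (forall n, opn (u n) /\ u n 1) /\
    forall n x y, u (S n) x -> u (S n) y -> u n (x * y).
Proof.
intros Hsq oU U1.
(* Choice needs a total [r]: a set that is not an open neighbourhood of 1 gets itself as a dummy
   value. *)
assert (H : forall V, exists W, opn V /\ V 1 ->
          (opn W /\ W 1) /\ forall x y, W x -> W y -> V (x * y)).
{ intros V; destruct (classic (opn V /\ V 1)) as [[oV V1]|n].
  - destruct (Hsq V oV V1) as (W & oW & W1 & HW); exists W; tauto.
  - exists V; tauto. }
destruct (functional_choice _ H) as [r Hr].
set (u := fix u n := match n with 0 => U | S k => r (u k) end).
assert (Hu : forall n, opn (u n) /\ u n 1).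
{ induction n as [|n IH]; [now split|now apply (Hr (u n))]. }
exists u; split; [easy|split; [exact Hu|]].
intros n; apply (Hr (u n)), Hu.
Qed.

(* If inverses of points arbitrarily close to 1 avoid the closure of U, multiplying such points
   x_0 x_1 ... x_n along a sequence of shrinking neighbourhoods yields a sequence of open sets
   whose accumulation point forces some inverse back into the closure of U. *)
Lemma inverse_adherent (U0 U : K -> Prop) :
  square_root_nbhds ->
  opn U0 -> U0 1 ->
  (forall A, nonempty_open_seq A -> (forall n x, A n x -> U0 x) ->
     exists p, clusters_at A p) ->
  opn U -> U 1 ->
  exists V, opn V /\ V 1 /\ forall x, V x -> adherent U x^-1.
Proof.
intros Hsq oU0 U01 Hacc oU U1.
apply NNPP; intros Hno.
assert (Hx : forall V, opn V -> V 1 -> exists x, V x /\ ~ adherent U x^-1).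
{ intros V oV V1; apply NNPP; intros H; apply Hno.
  exists V; repeat split; auto; intros x Vx; apply NNPP; intros nx; apply H; now exists x. }
destruct (square_root_sequence (fun x => U x /\ U0 x)) as (u & Hu0 & Hu & Hmul); auto.
assert (Hdec : forall n x, u (S n) x -> u n x).
{ intros n x ux; rewrite <- (gone_r K x); apply Hmul; [easy|apply Hu]. }
assert (Hdec1 : forall n x, u (S n) x -> u 1%nat x).
{ induction n; auto. }
destruct (functional_choice (fun n x => u (S (S n)) x /\ ~ adherent U x^-1)) as [x xP].
{ intros n; apply Hx; apply Hu. }
(* [y n] is the product of [x 0] up to [x (n-1)], so [y 0] is 1. *)
set (y := fix y n := match n with 0 => 1 | S k => y k * x k end).
assert (HO : forall n, exists O, opn O /\ O 1 /\ (forall z, O z -> u (S n) z) /\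
                  forall z, O z -> ~ adherent U ((x n)^-1 * z)).
{ intros n; destruct (xP n) as [_ nx].
  apply not_all_ex_not in nx as [Q nQ].
  apply imply_to_and in nQ as [oQ nQ]; apply imply_to_and in nQ as [Qx nQ].
  exists (fun z => u (S n) z /\ Q ((x n)^-1 * z)); repeat split.
  - apply opn_inter; [apply Hu|now apply opn_mull].
  - apply Hu.
  - now rewrite gone_r.
  - tauto.
  - intros z [_ Qz] az; now apply nQ, az. }
destruct (functional_choice _ HO) as [O OP]; clear HO.
assert (Ou : forall n z, O n z -> u (S n) z) by (intros n z; apply OP).
(* The translates of [u (n+1)] by [y n] decrease, because [x n] lies in [u (n+2)] and a product of
   two elements of [u (n+2)] lies in [u (n+1)]. *)
assert (Hyu : forall k d z, u (S (d + k)) ((y (d + k))^-1 * z) -> u (S k) ((y k)^-1 * z)).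
{ intros k d; induction d as [|d IH]; intros z uz; [easy|].
  apply IH; apply (Hmul (S (d + k)) (x (d + k))) in uz; [|apply xP].
  now simpl in uz; rewrite ginv_mul, <- gassoc, gmulKV in uz. }
destruct (Hacc (fun n z => O n ((y n)^-1 * z))) as [g Hg].
{ intros n; split; [now apply opn_mull, OP|].
  exists (y n); rewrite ginv_l; apply OP. }
{ intros n z Oz; apply Ou in Oz.
  rewrite <- (Nat.add_0_r n) in Oz; apply Hyu in Oz.
  simpl in Oz; rewrite ginv_one, gone_l in Oz; apply Hdec in Oz; now apply Hu0 in Oz. }
destruct (Hg (fun z => u 1%nat (g^-1 * z))) with (N := 0) as (n & _ & z & Oz & uz).
{ now apply opn_mull, Hu. }
{ rewrite ginv_l; apply Hu. }
apply (OP n) in Oz as Hz; apply Hz; clear Hz.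
(* It remains to see that [(y (n+1))^-1 * z] is adherent to [U]. Write it as
   [(y (n+1))^-1 * g * (g^-1 * z)] and replace the middle [g] by a nearby [t] from a later set: both
   [(y (n+1))^-1 * t] and [g^-1 * z] are in [u 1], so the product is in [U]. *)
intros Q oQ Qz.
destruct (Hg (fun t => Q ((y (S n))^-1 * t * (g^-1 * z)))) with (N := S n)
  as (k & Hk & t & Ot & Qt).
{ now apply (opn_mull _ (fun t => Q (t * (g^-1 * z)))), opn_mulr. }
{ rewrite <- gassoc, gmulKV; simpl; now rewrite ginv_mul, <- gassoc. }
exists ((y (S n))^-1 * t * (g^-1 * z)); split; [easy|].
apply Ou in Ot; replace k with ((k - S n) + S n)%nat in Ot by lia; apply Hyu in Ot.
apply Hu0, Hmul; [|easy].
now apply Hdec1 in Ot.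
Qed.

(* [Z] stands for the traces on [K] of the neighbourhoods of an adjoined zero adherent to [K]. *)
Variable Z : (K -> Prop) -> Prop.
Hypothesis Z_opn : forall W, Z W -> opn W.
Hypothesis Z_full : Z (fun _ => True).
Hypothesis Z_inter : forall V W, Z V -> Z W -> Z (fun x => V x /\ W x).
Hypothesis Z_mull : forall g W, Z W -> Z (fun x => W (g * x)).
Hypothesis Z_mulr : forall g W, Z W -> Z (fun x => W (x * g)).
Hypothesis Z_nonempty : forall W, Z W -> exists x, W x.
Hypothesis Z_separated :
  exists U W, opn U /\ U 1 /\ Z W /\ forall x, U x -> W x -> False.

Lemma Z_list (A : Type) (l : list A) (W : A -> K -> Prop) :
  (forall a, In a l -> Z (W a)) ->
  exists V, Z V /\ forall x, V x -> forall a, In a l -> W a x.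
Proof.
induction l as [|a l IH]; intros H.
- exists (fun _ => True); now split.
- destruct IH as (V & ZV & HV); [now intros b Hb; apply H; right|].
  exists (fun x => W a x /\ V x); split.
  + now apply Z_inter; [apply H; left|].
  + intros x [Wx Vx] b [<-|Hb]; auto.
Qed.

(** If finitely many [f * U] covered the group, a point [x] in all the [f * W] would lie in some
    [f * U], putting [f^-1 * x] in both [U] and [W]. *)
Lemma not_left_precompact :
  ~ (forall U, opn U -> U 1 ->
       exists l : list K, forall x, exists f u, In f l /\ U u /\ x = f * u).
Proof.
intros H; destruct Z_separated as (U & W & oU & U1 & ZW & UW).
destruct (H U oU U1) as [l Hl].
destruct (Z_list _ l (fun f x => W (f^-1 * x))) as (V & ZV & HV); [now intros; apply Z_mull|].
destruct (Z_nonempty V ZV) as [x Vx].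
destruct (Hl x) as (f & u & Hf & Uu & ->).
apply (UW u Uu); rewrite <- (gmulVK _ f u); now apply HV.
Qed.

(** A cluster point of the sets [V n] lies in some open [f m * U], which [V n] misses as soon as
    [m <= n]. *)
Lemma not_left_omega_precompact_feebly_compact :
  (forall A, nonempty_open_seq A -> exists p, clusters_at A p) ->
  ~ (forall U, opn U -> U 1 ->
       exists f : nat -> K, forall x, exists n u, U u /\ x = f n * u).
Proof.
intros Hacc H; destruct Z_separated as (U & W & oU & U1 & ZW & UW).
destruct (H U oU U1) as [f Hf].
assert (HV : forall n, exists V, Z V /\
              forall x, V x -> forall m, In m (seq 0 (S n)) -> W ((f m)^-1 * x)).
{ intros n; apply (Z_list _ _ (fun m x => W ((f m)^-1 * x))); intros; now apply Z_mull. }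
destruct (functional_choice _ HV) as [V VP].
destruct (Hacc V) as [p Hp].
{ intros n; split; [apply Z_opn|apply Z_nonempty]; apply VP. }
destruct (Hf p) as (m & u & Uu & ->).
destruct (Hp (fun x => U ((f m)^-1 * x))) with (N := m) as (n & Hn & x & Vx & Ux).
{ now apply opn_mull. }
{ now rewrite gmulVK. }
apply (UW _ Ux), (VP n); [easy|apply in_seq; lia].
Qed.

(* Pick x_n ever closer to zero, so that x_n x_m^-1 is close to zero too when m < n; the open
   sets x_n^-1 V then can neither cluster at a point of K nor, when Z is multiplicative, at zero. *)
Lemma not_jointly_continuous_feebly_compact :
  square_root_nbhds ->
  (forall A, nonempty_open_seq A ->
     (exists p, clusters_at A p) \/
     (forall W, Z W -> exists V, Z V /\ forall x y, V x -> V y -> W (x * y)) /\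
     (forall W, Z W -> frequently_meets A W)) -> False.
Proof.
intros Hsq Hacc; destruct Z_separated as (U0 & W & oU0 & U01 & ZW & UW).
destruct (square_root_sequence U0) as (u & Hu0 & Hu & Hmul); auto.
(* The index 2 is chosen so that a product of four elements of [u 2] lies in [U0]. Sets inside [U0]
   miss [W], so for them [Hacc] can only give a cluster point in the group. *)
destruct (inverse_adherent U0 (u 2)) as (V & oV & V1 & HV); auto; try apply Hu.
{ intros A HA AU0; destruct (Hacc A HA) as [|[_ HZ]]; [easy|].
  destruct (HZ W ZW 0) as (n & _ & x & Ax & Wx); now destruct (UW x); eauto. }
set (V' := fun x => V x /\ u 2 x).
assert (HV'0 : forall x, V' x -> U0 x).
{ intros x [_ ux]; apply Hu0; rewrite <- (gone_r _ x), <- (gone_r _ (x * 1)).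
  apply Hmul; [apply Hmul; [easy|]|]; apply Hu. }
assert (oV' : opn V') by (apply opn_inter; [easy|apply Hu]).
(* [N] must be fixed before [Hacc] reveals which alternative holds; if [Z] is not multiplicative,
   [W] is a dummy value. *)
assert (HN : exists N, Z N /\
  ((forall W, Z W -> exists V, Z V /\ forall x y, V x -> V y -> W (x * y)) ->
   forall x y, N x -> N y -> W (x * y))).
{ destruct (classic (forall W, Z W -> exists V, Z V /\ forall x y, V x -> V y -> W (x * y)))
    as [H|H].
  - destruct (H W ZW) as (N & ZN & HN); now exists N.
  - now exists W. }
destruct HN as (N & ZN & HN).
destruct (history_sequence K (fun l x => N x /\ forall y, In y l -> W (x * y^-1)))
  as [x Hx].
{ intros l.
  destruct (Z_list _ l (fun y x => W (x * y^-1))) as (Q & ZQ & HQ); [now intros; apply Z_mulr|].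
  destruct (Z_nonempty (fun x => N x /\ Q x)) as [x [Nx Qx]]; [now apply Z_inter|].
  exists x; auto. }
destruct (Hacc (fun n z => V' (x n * z))) as [[g Hg]|[HZ HA]].
{ intros n; split; [now apply opn_mull|].
  exists (x n)^-1; rewrite ginv_r; split; [easy|apply Hu]. }
- assert (oQ : opn (fun z => V' (g^-1 * z))) by now apply opn_mull.
  assert (Qg : V' (g^-1 * g)) by (rewrite ginv_l; split; [easy|apply Hu]).
  destruct (Hg _ oQ Qg 0) as (m & _ & z & [Az _] & [_ Bz]).
  destruct (Hg _ oQ Qg (S m)) as (n & Hn & t & [_ At] & [Bt _]).
  destruct (Hx n) as (l & [_ Hl] & Hin); specialize (Hl _ (Hin m Hn)).
  (* The element [x n * (x m)^-1] of [W] factors as [(x n * t) * (g^-1 * t)^-1 * (g^-1 * z) * (x m *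
     z)^-1]. The two inverses are adherent to [u 2]; replacing them in turn by [a] and [b] from
     [u 2] keeps the product in [W] and brings it into [U0]. *)
  destruct (HV _ Bt) with (Q := fun s => W (x n * t * s * (g^-1 * z * (x m * z)^-1)))
    as (a & Wa & ua).
  { apply (opn_mull _ (fun s => W (s * (g^-1 * z * (x m * z)^-1)))), opn_mulr, Z_opn, ZW. }
  { now rewrite !ginv_mul, ginv_inv, <- !gassoc, !gmulKV. }
  destruct (HV _ Az) with (Q := fun s => W (x n * t * a * (g^-1 * z * s))) as (b & Wb & ub).
  { now apply (opn_mull _ (fun s => W (x n * t * a * s))), opn_mull, Z_opn. }
  { easy. }
  refine (UW _ _ Wb).
  now apply Hu0, Hmul; apply Hmul.
- destruct (HA N ZN 0) as (n & _ & z & Vz & Nz).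
  apply (UW (x n * z)); [now apply HV'0|].
  apply HN; [easy| |easy]; now destruct (Hx n) as (l & [Nx _] & _).
Qed.
End ZeroFilter.

(** * General topology: retracts and cluster points in pseudocompact spaces *)

Lemma set_ext (X : Type) (A B : X -> Prop) : (forall x, A x <-> B x) -> A = B.
Proof.
now intros H; apply functional_extensionality; intros x; apply propositional_extensionality.
Qed.

Section Topological.
Variable X : Type.
Variable T : topology X.

Lemma open_ext (A B : X -> Prop) : (forall x, A x <-> B x) -> open T A -> open T B.
Proof. now intros H oA; rewrite <- (set_ext _ _ _ H). Qed.

Lemma open_local (A : X -> Prop) :
  (forall x, A x -> exists O, open T O /\ O x /\ forall y, O y -> A y) -> open T A.
Proof.
intros H.
apply open_ext with
  (A := fun x => exists U, (open T U /\ forall y, U y -> A y) /\ U x).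
- intros x; split; [now intros (U & [_ HU] & Ux); apply HU|].
  intros Ax; destruct (H x Ax) as (O & oO & Ox & HO); now exists O.
- now apply open_union.
Qed.

Lemma open_union2 (A B : X -> Prop) :
  open T A -> open T B -> open T (fun x => A x \/ B x).
Proof.
intros oA oB; apply open_local; intros x [Ax|Bx]; [exists A|exists B]; auto.
Qed.

Lemma open_rel_open (A U : X -> Prop) : open T U -> rel_open T A (fun x => A x /\ U x).
Proof. intros oU; split; [tauto|]; exists U; split; [easy|tauto]. Qed.

Lemma continuous_comp (f g : X -> X) :
  continuous T f -> continuous T g -> continuous T (fun x => f (g x)).
Proof. intros Hf Hg U oU; now apply (Hg (fun x => U (f x))), Hf. Qed.

Lemma continuous_rel_cont (A B : X -> Prop) (f : X -> X) :
  continuous T f -> (forall x, A x -> B (f x)) -> rel_cont T A B f.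
Proof.
intros Hf HAB; split; [easy|]; intros V [HV (O & oO & HO)]; split; [tauto|].
exists (fun x => O (f x)); split; [now apply Hf|].
intros x Ax; specialize (HO (f x) (HAB x Ax)); tauto.
Qed.

(** Preimages under [r] of a locally finite family on [A] form a locally finite family on the whole
    space, and each member is recovered as the trace on [A] of its preimage. *)
Lemma pseudocompact_retract (A : X -> Prop) (r : X -> X) :
  pseudocompact_sub T (fun _ => True) -> continuous T r ->
  (forall x, A (r x)) -> (forall x, A x -> r x = x) -> pseudocompact_sub T A.
Proof.
intros Hpc Hr HA Hfix F HF Hlf.
destruct (Hpc (fun V => exists U, F U /\ V = fun x => U (r x))) as [l Hl].
- intros V (U & FU & ->); destruct (HF U FU) as [[HUA (O & oO & HO)] [x Ux]]; split.
  + split; [easy|]; exists (fun x => O (r x)); split; [now apply Hr|].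
    intros y _; apply HO, HA.
  + exists x; now rewrite Hfix by auto.
- intros x _; destruct (Hlf (r x) (HA x)) as (W & [_ (O & oO & HO)] & Wx & l & Hl).
  exists (fun x => O (r x)); split; [|split].
  + split; [easy|]; exists (fun x => O (r x)); split; [now apply Hr|easy].
  + now apply HO.
  + exists (map (fun U x => U (r x)) l).
    intros V (U & FU & ->) (y & Uy & Oy).
    apply (in_map (fun (U : X -> Prop) (x : X) => U (r x))), Hl; [easy|].
    exists (r y); split; [easy|]; now apply HO.
- exists (map (fun V x => A x /\ V x) l); intros U FU.
  assert (HU : U = fun x => A x /\ U (r x)).
  { apply set_ext; intros x; destruct (HF U FU) as [[HUA _] _]; split.
    - intros Ux; split; [auto|]; now rewrite Hfix by auto.
    - intros [Ax Ux]; now rewrite Hfix in Ux. }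
  rewrite HU; apply (in_map (fun (V : X -> Prop) (x : X) => A x /\ V x)), Hl; now exists U.
Qed.

(** The last two hypotheses express continuity of the retraction that fixes [A] and sends the rest
    to [p]. This form also covers sets [A] that are not open. *)
Lemma pseudocompact_collapse (A : X -> Prop) (p : X) :
  pseudocompact_sub T (fun _ => True) -> A p ->
  (forall U, open T U -> U p -> open T (fun x => U x \/ ~ A x)) ->
  (forall U, open T U -> ~ U p -> open T (fun x => U x /\ A x)) ->
  pseudocompact_sub T A.
Proof.
intros Hpc Ap Hin Hout.
apply pseudocompact_retract with (r := fun x => if decP (A x) then x else p); [easy|..].
- intros U oU; destruct (classic (U p)) as [Up|nUp].
  + apply open_ext with (2 := Hin U oU Up); intros x; destruct (decP (A x)); tauto.
  + apply open_ext with (2 := Hout U oU nUp); intros x; destruct (decP (A x)); tauto.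
- intros x; now destruct (decP (A x)).
- intros x Ax; now destruct (decP (A x)).
Qed.

Lemma pseudocompact_clopen (A : X -> Prop) :
  pseudocompact_sub T (fun _ => True) -> clopen T A -> (exists p, A p) ->
  pseudocompact_sub T A.
Proof.
intros Hpc [oA cA] [p Ap]; apply pseudocompact_collapse with p; [easy|easy|..].
- intros U oU _; now apply open_union2.
- intros U oU _; now apply open_inter.
Qed.

Lemma pigeonhole (A : Type) (f : nat -> A) (l : list A) :
  (forall n, In (f n) l) ->
  exists a, forall N, exists n, N <= n /\ f n = a.
Proof.
intros Hl; apply NNPP; intros H.
assert (Hbound : exists N, forall n, N <= n -> forall a, In a l -> f n <> a).
{ clear Hl; induction l as [|a l [N HN]]; [now exists 0|].
  destruct (not_all_ex_not _ _ (not_ex_all_not _ _ H a)) as [M HM].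
  exists (N + M); intros n Hn b [<-|Hb].
  - intros E; apply HM; exists n; split; [lia|easy].
  - apply HN; [lia|easy]. }
destruct Hbound as [N HN]; now apply (HN N (Nat.le_refl N) (f N)).
Qed.

(** Without a cluster point the family of the [V n] is locally finite, hence finite as a family of
    sets. One set then recurs for infinitely many indices, and any of its points is a cluster point
    after all. *)
Lemma pseudocompact_cluster_point (A : X -> Prop) (V : nat -> X -> Prop) :
  pseudocompact_sub T A ->
  (forall n, rel_open T A (V n) /\ exists x, V n x) ->
  exists p, A p /\ forall W, rel_open T A W -> W p ->
    forall N, exists n, N <= n /\ exists x, V n x /\ W x.
Proof.
intros Hpc HV; apply NNPP; intros Hno.
destruct (Hpc (fun U => exists n, U = V n)) as [l Hl].
- now intros U [n ->].
- intros p Ap; apply NNPP; intros Hp; apply Hno; exists p; split; [easy|].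
  intros W oW Wp N; apply NNPP; intros HN; apply Hp; exists W; split; [easy|split; [easy|]].
  exists (map V (seq 0 N)); intros U [n ->] (y & Vy & Wy).
  apply in_map, in_seq; split; [lia|].
  destruct (Nat.lt_ge_cases n N); [easy|].
  destruct HN; exists n; split; [easy|now exists y].
- destruct (pigeonhole _ V l) as [U HU]; [now intros n; apply Hl; exists n|].
  destruct (HU 0) as (n0 & _ & <-); destruct (HV n0) as [[HA _] [p Vp]].
  apply Hno; exists p; split; [auto|]; intros W _ Wp N.
  destruct (HU N) as (n & Hn & E); exists n; split; [easy|exists p; now rewrite E].
Qed.

End Topological.

(** * Algebra of orthogonal sums of Brandt semigroups *)

Section BrandtSum.
Variable I : Type.
Variable L : I -> Type.
Variable G : I -> Grp.
Local Notation S := (Bsum L G).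

(** Turns membership in a cell into an equation, so that disjointness of distinct cells becomes
    plain rewriting. *)
Definition cell_index (s : S) : option {i : I & (L i * L i)%type} :=
  match s with
  | Some (existT _ i (a, _, b)) => Some (existT (fun i => (L i * L i)%type) i (a, b))
  | None => None
  end.

Lemma Hset_index (i : I) (a b : L i) (s : S) :
  Hset i a b s <-> cell_index s = Some (existT (fun i => (L i * L i)%type) i (a, b)).
Proof.
split; [now intros [g ->]|].
destruct s as [[j [[c g] d]]|]; [|easy]; simpl; intros E.
injection E as -> Ea Eb; apply inj_pair2 in Ea as ->; apply inj_pair2 in Eb as ->; now exists g.
Qed.

Lemma elt_inj (i : I) (a b : L i) (g h : G i) :
  elt (L := L) (G := G) i a g b = elt i a h b -> g = h.
Proof. intros E; injection E as E; now apply inj_pair2 in E. Qed.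

Lemma Bsum_cases (s : S) : s = None \/ exists i a g b, s = elt i a g b.
Proof. destruct s as [[i [[a g] b]]|]; [right; now exists i, a, g, b|now left]. Qed.

Lemma bmul_elt (i : I) (a b c : L i) (g h : G i) :
  bmul (elt (L := L) (G := G) i a g b) (elt i b h c) = elt i a (gmul (G i) g h) c.
Proof.
unfold bmul, elt; destruct (decP (i = i)) as [e|]; [|easy].
rewrite <- eq_rect_eq; now destruct (decP (b = b)).
Qed.

Lemma bmul_None_r (s : S) : bmul s None = None.
Proof. now destruct s as [[i [[a g] b]]|]. Qed.

Lemma bmul_elt_l (i : I) (a b : L i) (x : G i) (s : S) :
  bmul (elt i a x b) s <> None -> exists g c, s = elt i b g c.
Proof.
destruct s as [[j [[c g] d]]|]; [|easy].
unfold bmul, elt; destruct (decP (j = i)) as [e|]; [|easy].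
destruct e; simpl; destruct (decP (b = c)) as [->|]; [|easy].
intros _; now exists g, d.
Qed.

Lemma bmul_elt_r (i : I) (a b : L i) (x : G i) (s : S) :
  bmul s (elt i a x b) <> None -> exists c g, s = elt i c g a.
Proof.
destruct s as [[j [[c g] d]]|]; [|easy].
unfold bmul, elt; destruct (decP (i = j)) as [e|]; [|easy].
destruct e; simpl; destruct (decP (d = a)) as [->|]; [|easy].
intros _; now exists c, g.
Qed.

(** A two-sided translation that maps the cell at [a, b] bijectively onto the cell at [c, d] and
    everything else to zero: it both detects a cell and identifies two of them. *)
Definition sandwich (i : I) (c a b d : L i) (x y : G i) (s : S) : S :=
  bmul (bmul (elt i c x a) s) (elt i b y d).

Lemma sandwich_elt (i : I) (c a b d : L i) (x y g : G i) :
  sandwich i c a b d x y (elt i a g b) = elt i c (gmul (G i) (gmul (G i) x g) y) d.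
Proof. unfold sandwich; now rewrite !bmul_elt. Qed.

Lemma sandwich_nonzero (i : I) (c a b d : L i) (x y : G i) (s : S) :
  sandwich i c a b d x y s <> None -> Hset i a b s.
Proof.
unfold sandwich; intros H.
destruct (bmul_elt_l i c a x s) as (g & e & ->).
{ intros E; now rewrite E in H. }
rewrite bmul_elt in H; apply bmul_elt_r in H as (a' & g' & E).
exists g.
assert (E' := f_equal cell_index E); simpl in E'.
injection E' as Ec Ed; apply inj_pair2 in Ed as ->; easy.
Qed.

Lemma sandwich_one (i : I) (c a b d : L i) (g : G i) :
  sandwich i c a b d (gone (G i)) (gone (G i)) (elt i a g b) = elt i c g d.
Proof. now rewrite sandwich_elt, gone_l, gone_r. Qed.

Lemma sandwich_cancel (i : I) (c a b d : L i) (x y : G i) (s : S) :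
  Hset i a b s ->
  sandwich i a c d b (ginv (G i) x) (ginv (G i) y) (sandwich i c a b d x y s) = s.
Proof.
intros [g ->]; rewrite !sandwich_elt, <- !gassoc, gmulVK, ginv_r; now rewrite gone_r.
Qed.

Lemma Hset_subgroup (i : I) (a : L i) (s t : S) :
  Hset i a a s -> Hset i a a t -> Hset i a a (bmul s t).
Proof. intros [g ->] [h ->]; rewrite bmul_elt; now eexists. Qed.

Lemma Hset_list (i : I) (a b : L i) (l : list S) :
  (forall s, In s l -> Hset i a b s) -> exists l', l = map (fun g => elt i a g b) l'.
Proof.
induction l as [|s l IH]; intros H; [now exists nil|].
destruct IH as [l' ->]; [now intros t Ht; apply H; right|].
destruct (H s) as [g ->]; [now left|]; now exists (g :: l').
Qed.

(** * Topology of the cells and of zero *)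

Section Continuity.
Variable T : topology S.
Hypothesis HS : semitop_semigroup T (@bmul I L G).

Lemma continuous_mull (s : S) : continuous T (fun x => bmul s x).
Proof. apply HS. Qed.

Lemma continuous_mulr (s : S) : continuous T (fun x => bmul x s).
Proof. apply HS. Qed.

Lemma continuous_sandwich (i : I) (c a b d : L i) (x y : G i) :
  continuous T (sandwich i c a b d x y).
Proof.
apply (continuous_comp _ T (fun s => bmul s (elt i b y d)) (fun s => bmul (elt i c x a) s)).
- apply continuous_mulr.
- apply continuous_mull.
Qed.

Lemma open_nonzero : open T (fun s => s <> None).
Proof.
destruct HS as [Hh _]; apply open_local; intros s Hs.
destruct (Hh s None Hs) as (U & V & oU & _ & Us & V0 & UV).
exists U; split; [easy|split; [easy|]]; intros t Ut ->; now apply (UV None).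
Qed.

Lemma open_Hset (i : I) (a b : L i) : open T (Hset i a b).
Proof.
set (e := gone (G i)).
apply open_ext with (A := fun s => sandwich i a a b b e e s <> None).
- intros s; split; [apply sandwich_nonzero|].
  intros [g ->]; unfold e; now rewrite sandwich_one.
- apply (continuous_sandwich _ _ _ _ _ _ _ (fun s => s <> None)), open_nonzero.
Qed.

Lemma open_not_Bset (i : I) : open T (fun s => ~ Bset i s).
Proof.
apply open_local; intros s Hs.
destruct (Bsum_cases s) as [->|(j & a & g & b & ->)]; [now destruct Hs; left|].
exists (Hset j a b); split; [apply open_Hset|split; [now exists g|]].
intros t [h ->] [|(c & k & d & E)]; [easy|]; apply Hs; right.
injection E as E1 E2; destruct E1; now exists a, g, b.
Qed.

(** The complement of [Bset i] is collapsed to zero. An open set missing zero meets [Bset i] in a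
    union of open pieces of cells. *)
Lemma pseudocompact_Bset (i : I) :
  pseudocompact_sub T (fun _ => True) -> pseudocompact_sub T (@Bset I L G i).
Proof.
intros Hpc; apply pseudocompact_collapse with (p := None); [easy|now left|..].
- intros U oU _; apply open_union2; [easy|apply open_not_Bset].
- intros U oU U0; apply open_local; intros s [Us [->|(a & g & b & ->)]]; [easy|].
  exists (fun t => U t /\ Hset i a b t); split; [|split].
  + apply open_inter; [easy|apply open_Hset].
  + split; [easy|now exists g].
  + intros t [Ut [h ->]]; split; [easy|right; now exists a, h, b].
Qed.

Definition zero_isolated_from (A : S -> Prop) : Prop :=
  exists O, open T O /\ O None /\ forall s, O s -> A s -> False.

Lemma zero_isolated_translate (i : I) (a b c d : L i) :
  zero_isolated_from (Hset i a b) -> zero_isolated_from (Hset i c d).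
Proof.
set (e := gone (G i)); intros (O & oO & O0 & HO).
exists (fun s => O (sandwich i a c d b e e s)); split; [|split].
- now apply continuous_sandwich.
- unfold sandwich; now rewrite bmul_None_r.
- intros s Os [g ->]; apply (HO _ Os); unfold e; rewrite sandwich_one; now exists g.
Qed.

(** A non-zero point outside the cell lies in another cell, which is open and disjoint; zero is thus
    the only possible limit point outside. *)
Lemma clopen_Hset (i : I) (a b : L i) :
  zero_isolated_from (Hset i a b) -> clopen T (@Hset I L G i a b).
Proof.
intros (O & oO & O0 & HO); split; [apply open_Hset|].
apply open_local; intros s Hs.
destruct (Bsum_cases s) as [->|(j & c & g & d & ->)].
- exists O; split; [easy|split; [easy|]]; intros t Ot Ht; now apply (HO t).
- exists (Hset j c d); split; [apply open_Hset|split; [now exists g|]].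
  intros t Ht Ht'; apply Hs, Hset_index; apply Hset_index in Ht, Ht'.
  now rewrite <- Ht', Ht.
Qed.

Lemma rel_cont_sandwich (i : I) (a b c d : L i) (x y : G i) :
  rel_cont T (Hset i a b) (Hset i c d) (sandwich i c a b d x y).
Proof.
apply continuous_rel_cont; [apply continuous_sandwich|].
intros s [g ->]; rewrite sandwich_elt; now eexists.
Qed.

Lemma homeomorphic_Hset (i : I) (a b c d : L i) :
  homeomorphic_sub T (@Hset I L G i a b) (@Hset I L G i c d).
Proof.
set (e := gone (G i)).
exists (sandwich i c a b d e e), (sandwich i a c d b e e).
split; [apply rel_cont_sandwich|split; [apply rel_cont_sandwich|split]];
  intros s [g ->]; unfold e; now rewrite !sandwich_one.
Qed.

Lemma top_iso_Hset (i : I) (a b : L i) :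
  top_iso_sub T (@bmul I L G) (@Hset I L G i a a) (@Hset I L G i b b).
Proof.
set (e := gone (G i)).
exists (sandwich i b a a b e e), (sandwich i a b b a e e).
split; [apply rel_cont_sandwich|split; [apply rel_cont_sandwich|split; [|split]]].
- intros s [g ->]; unfold e; now rewrite !sandwich_one.
- intros s [g ->]; unfold e; now rewrite !sandwich_one.
- intros s t [g ->] [h ->]; unfold e; now rewrite bmul_elt, !sandwich_one, bmul_elt.
Qed.

Lemma semitop_Hset (i : I) (a : L i) :
  semitop_sub T (@bmul I L G) (@Hset I L G i a a).
Proof.
split; [apply Hset_subgroup|]; intros s Hs; split.
- apply continuous_rel_cont; [apply continuous_mull|]; intros; now apply Hset_subgroup.
- apply continuous_rel_cont; [apply continuous_mulr|]; intros; now apply Hset_subgroup.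
Qed.

Lemma base_at_translate (i : I) (a : L i) (Bf : (S -> Prop) -> Prop) :
  base_at T Bf (elt i a (gone (G i)) a) ->
  (forall U, Bf U -> forall s, U s -> Hset i a a s) ->
  forall (b c : L i) (x : G i),
    base_at T
      (fun V => exists U, Bf U /\
         forall s, V s <-> setmul3 (elt i b x a) U (elt i a (gone (G i)) c) s)
      (elt i b x c).
Proof.
intros [Hopen Hbase] Hsub b c x; set (e := gone (G i)).
assert (Hf : sandwich i b a a c x e (elt i a e a) = elt i b x c).
{ unfold e; now rewrite sandwich_elt, !gone_r. }
split.
- intros V (U & BU & HV); destruct (Hopen U BU) as [oU Ue]; split.
  (* The translate of [U] is open because it is the preimage of [U] under the inverse translation
     [h]; off the cell at [b, c] the value of [h] is zero, which is not in [U]. *)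
  + set (h := sandwich i a b c a (ginv (G i) x) (ginv (G i) e)).
    apply open_ext with (A := fun s => U (h s)).
    * intros s; rewrite HV; split.
      -- intros Uh; exists (h s); split; [easy|].
         assert (Hs : Hset i b c s).
         { apply (sandwich_nonzero i a b c a (ginv (G i) x) (ginv (G i) e)).
           intros E; fold h in E; rewrite E in Uh; now destruct (Hsub U BU _ Uh). }
         rewrite <- (sandwich_cancel i a b c a (ginv (G i) x) (ginv (G i) e) s Hs) at 1.
         now rewrite !ginv_inv.
      -- intros (u & Uu & ->).
         fold (sandwich i b a a c x e u).
         unfold h; rewrite (sandwich_cancel i b a a c x e); [easy|now apply (Hsub U)].
    * now apply continuous_sandwich.
  + apply HV; exists (elt i a e a); now split.
- intros W oW Wx.
  destruct (Hbase (fun s => W (sandwich i b a a c x e s))) as (U & BU & HU).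
  + now apply continuous_sandwich.
  + unfold e in *; now rewrite Hf.
  + exists (setmul3 (elt i b x a) U (elt i a e c)); split; [now exists U|].
    intros s (u & Uu & ->); now apply (HU u).
Qed.

Definition index_set (t : {i : I & (L i * L i)%type}) : S -> Prop :=
  Hset (projT1 t) (fst (projT2 t)) (snd (projT2 t)).

Lemma index_set_cell_index (t : {i : I & (L i * L i)%type}) (s : S) :
  index_set t s <-> cell_index s = Some t.
Proof. destruct t as [i [a b]]; apply Hset_index. Qed.

Lemma open_outside_cells (l : list {i : I & (L i * L i)%type}) :
  (forall i (a b : L i), clopen T (@Hset I L G i a b)) ->
  open T (fun s => ~ exists t, In t l /\ index_set t s).
Proof.
intros Hcl; induction l as [|t l IH].
- apply open_ext with (2 := open_full T); intros s; split; [|easy].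
  now intros _ (t & [] & _).
- apply open_ext with (2 := open_inter T _ _ (proj2 (Hcl (projT1 t) (fst (projT2 t)) (snd (projT2 t)))) IH); intros s; split.
  + intros [H1 H2] (t' & [<-|Ht'] & Hs); [now apply H1|apply H2; now exists t'].
  + intros H; split; intros Hs; apply H; [exists t|destruct Hs as (t' & Ht' & Hs); exists t'];
      split; simpl; auto.
Qed.

(* In a regular open neighbourhood of zero, a cell contained in the closure is contained in the
   neighbourhood; the remaining cells leave non-empty traces outside the closure, and these
   traces form a locally finite family. *)
Lemma zero_family_base :
  pseudocompact_sub T (fun _ => True) ->
  (forall i (a b : L i), clopen T (@Hset I L G i a b)) ->
  semiregular T -> base_at T (@zero_family I L G) None.
Proof.
intros Hpc Hcl Hsr; split.
- intros V [l Hl]; split.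
  + apply open_ext with (2 := open_outside_cells l Hcl); intros s; symmetry; apply Hl.
  + apply Hl; now intros (t & _ & [g E]).
- intros W oW W0; destruct (Hsr W None oW W0) as (U & oU & rU & U0 & UW).
  set (trace := fun t s => index_set t s /\ ~ closure T U s).
  assert (oncl : open T (fun s => ~ closure T U s)).
  { apply open_local; intros s Hs; apply not_all_ex_not in Hs as [O HO].
    apply imply_to_and in HO as [oO HO]; apply imply_to_and in HO as [Os HO].
    exists O; split; [easy|split; [easy|]]; intros t Ot Ht; now apply HO, Ht. }
  destruct (Hpc (fun V => exists t, V = trace t /\ exists s, V s)) as [l Hl].
  + intros V (t & -> & Hs); split; [|easy]; split; [easy|]; exists (trace t); split; [|easy].
    apply open_inter; [apply open_Hset|easy].
  (* Local finiteness: the cell of a non-zero [p] meets only its own trace, and [U] is a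
     neighbourhood of zero meeting no trace. *)
  + intros p _; destruct (cell_index p) as [t|] eqn:Ep.
    * exists (index_set t); split; [|split].
      -- split; [easy|]; exists (index_set t); split; [apply open_Hset|easy].
      -- now apply index_set_cell_index.
      -- exists (trace t :: nil); intros V (t' & -> & _) (s & [Hs _] & Hs'); left.
         apply index_set_cell_index in Hs, Hs'; congruence.
    * assert (p = None) as -> by now destruct p as [[i [[a g] b]]|].
      exists U; split; [|split; [easy|]].
      -- split; [easy|]; now exists U.
      -- exists nil; intros V (t & -> & _) (s & [_ Hs] & Us).
         destruct Hs; intros O oO Os; now exists s.
  (* A non-empty trace determines its cell, so the finite list of sets yields a finite list of cell
     indices. *)
  + assert (Hlt : exists lt, forall t s, In (trace t) l -> trace t s -> In t lt).
    { clear Hl; induction l as [|V l [lt Hlt]]; [now exists nil|].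
      destruct (classic (exists t s, V = trace t /\ trace t s)) as [(t & s & -> & ts)|nV].
      - exists (t :: lt); intros t' s' [E|Hin] ts'; [left|right; now apply (Hlt t' s')].
        apply (eq_ind _ (fun V => V s)) with (2 := E) in ts as ts2.
        destruct ts as [ts _], ts2 as [ts2 _].
        apply index_set_cell_index in ts, ts2; congruence.
      - exists lt; intros t s [E|Hin] ts; [destruct nV; now exists t, s|now apply (Hlt t s)]. }
    destruct Hlt as [lt Hlt].
    exists (fun s => ~ exists t, In t lt /\ index_set t s); split; [now exists lt|].
    (* A cell outside [lt] has empty trace, so it is an open set inside the closure of [U], and
       regularity of [U] absorbs it. *)
    intros s Hs; apply UW, rU.
    destruct (cell_index s) as [t|] eqn:Es.
    * apply index_set_cell_index in Es.
      exists (index_set t); split; [apply open_Hset|split; [easy|]].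
      intros s' Hs'; apply NNPP; intros nc.
      apply Hs; exists t; split; [|easy].
      assert (ts' : trace t s') by now split.
      apply (Hlt t s'); [|easy]; apply Hl; exists t; split; [easy|now exists s'].
    * assert (s = None) as -> by now destruct s as [[i [[a g] b]]|].
      now apply rU.
Qed.

(** * Transfer from a maximal subgroup of the semigroup to the abstract group *)

Section Trace.
Variable i : I.
Variable a : L i.
Local Notation K := (G i).
Local Notation "'el' g" := (elt (L := L) i a g a) (at level 10, g at level 9).

(** The subspace topology of the maximal subgroup at [a], carried over to [G i]. *)
Definition trace_open (U : K -> Prop) : Prop :=
  exists O, open T O /\ forall g, U g <-> O (el g).

Definition zero_trace (W : K -> Prop) : Prop :=
  exists O, open T O /\ O None /\ forall g, W g <-> O (el g).

Lemma trace_open_inter (U V : K -> Prop) :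
  trace_open U -> trace_open V -> trace_open (fun x => U x /\ V x).
Proof.
intros (O & oO & HO) (P & oP & HP); exists (fun s => O s /\ P s); split.
- now apply open_inter.
- intros g; now rewrite HO, HP.
Qed.

Lemma trace_open_mull (g : K) (U : K -> Prop) :
  trace_open U -> trace_open (fun x => U (gmul K g x)).
Proof.
intros (O & oO & HO); exists (fun s => O (bmul (el g) s)); split.
- now apply continuous_mull.
- intros h; now rewrite HO, bmul_elt.
Qed.

Lemma trace_open_mulr (g : K) (U : K -> Prop) :
  trace_open U -> trace_open (fun x => U (gmul K x g)).
Proof.
intros (O & oO & HO); exists (fun s => O (bmul s (el g))); split.
- now apply (continuous_mulr (el g)).
- intros h; now rewrite HO, bmul_elt.
Qed.

Lemma zero_trace_open (W : K -> Prop) : zero_trace W -> trace_open W.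
Proof. intros (O & oO & _ & HO); now exists O. Qed.

Lemma zero_trace_full : zero_trace (fun _ => True).
Proof. exists (fun _ => True); split; [apply open_full|easy]. Qed.

Lemma zero_trace_inter (V W : K -> Prop) :
  zero_trace V -> zero_trace W -> zero_trace (fun x => V x /\ W x).
Proof.
intros (O & oO & O0 & HO) (P & oP & P0 & HP); exists (fun s => O s /\ P s); split; [|split].
- now apply open_inter.
- easy.
- intros g; now rewrite HO, HP.
Qed.

Lemma zero_trace_mull (g : K) (W : K -> Prop) :
  zero_trace W -> zero_trace (fun x => W (gmul K g x)).
Proof.
intros (O & oO & O0 & HO); exists (fun s => O (bmul (el g) s)); split; [|split].
- now apply continuous_mull.
- easy.
- intros h; now rewrite HO, bmul_elt.
Qed.

Lemma zero_trace_mulr (g : K) (W : K -> Prop) :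
  zero_trace W -> zero_trace (fun x => W (gmul K x g)).
Proof.
intros (O & oO & O0 & HO); exists (fun s => O (bmul s (el g))); split; [|split].
- now apply (continuous_mulr (el g)).
- easy.
- intros h; now rewrite HO, bmul_elt.
Qed.

Lemma zero_trace_separated :
  exists U W, trace_open U /\ U (gone K) /\ zero_trace W /\ forall x, U x -> W x -> False.
Proof.
destruct HS as [Hh _].
destruct (Hh (el (gone K)) None) as (U & W & oU & oW & U1 & W0 & UW); [easy|].
exists (fun g => U (el g)), (fun g => W (el g)); split; [|split; [|split]].
- now exists U.
- easy.
- now exists W.
- intros g; apply UW.
Qed.

Lemma zero_trace_nonempty :
  ~ zero_isolated_from (Hset i a a) -> forall W, zero_trace W -> exists x, W x.
Proof.
intros H W (O & oO & O0 & HO); apply NNPP; intros nW; apply H.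
exists O; split; [easy|split; [easy|]].
intros s Os [g ->]; apply nW; exists g; now apply HO.
Qed.

Definition image (U : K -> Prop) (s : S) : Prop := exists g, s = el g /\ U g.

Lemma image_elt (U : K -> Prop) (g : K) : image U (el g) <-> U g.
Proof.
split; [|now exists g]; intros (h & E & Uh); now apply elt_inj in E as ->.
Qed.

Lemma open_image (U : K -> Prop) : trace_open U -> open T (image U).
Proof.
intros (O & oO & HO).
apply open_ext with (2 := open_inter T _ _ oO (open_Hset i a a)); intros s; split.
- intros [Os [g ->]]; exists g; split; [easy|now apply HO].
- intros (g & -> & Ug); split; [now apply HO|now exists g].
Qed.

Lemma rel_open_trace (A V : S -> Prop) :
  (forall s, Hset i a a s -> A s) -> rel_open T A V -> trace_open (fun g => V (el g)).
Proof.
intros HA [_ (O & oO & HO)]; exists O; split; [easy|].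
intros g; apply HO, HA; now exists g.
Qed.

Lemma rel_open_image (A : S -> Prop) (U : K -> Prop) :
  (forall s, Hset i a a s -> A s) -> trace_open U -> rel_open T A (image U).
Proof.
intros HA oU; split; [intros s (g & -> & _); apply HA; now exists g|].
exists (image U); split; [now apply open_image|easy].
Qed.

Lemma nbhd_image (U : K -> Prop) :
  trace_open U -> U (gone K) -> nbhd_in T (Hset i a a) (image U) (el (gone K)).
Proof.
intros oU U1; assert (oI := rel_open_image (Hset i a a) U (fun s H => H) oU).
split; [apply oI|]; exists (image U); split; [easy|split; [|easy]].
now apply image_elt.
Qed.

Lemma pseudocompact_trace_clusters (B : nat -> K -> Prop) :
  pseudocompact_sub T (@Hset I L G i a a) ->
  nonempty_open_seq K trace_open B -> exists p, clusters_at K trace_open B p.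
Proof.
intros Hpc HB.
destruct (pseudocompact_cluster_point S T (Hset i a a) (fun n => image (B n)))
  as (s & [p ->] & Hp).
- easy.
- intros n; destruct (HB n) as [oB [x Bx]]; split.
  + now apply rel_open_image.
  + exists (el x); now apply image_elt.
- exists p; intros Q oQ Qp N.
  destruct (Hp (image Q)) with (N := N) as (n & Hn & s & (g & -> & Bg) & Qg).
  + now apply rel_open_image.
  + now apply image_elt.
  + exists n; split; [easy|]; exists g; split; [easy|now apply image_elt].
Qed.

(** The cluster point found in the whole semigroup is in the subgroup or is zero, since every other
    cell is an open set missing the subgroup. *)
Lemma pseudocompact_clusters_or_zero (B : nat -> K -> Prop) :
  pseudocompact_sub T (fun _ => True) ->
  nonempty_open_seq K trace_open B ->
  (exists p, clusters_at K trace_open B p) \/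
  forall W, zero_trace W -> frequently_meets K B W.
Proof.
intros Hpc HB.
destruct (pseudocompact_cluster_point S T (fun _ => True) (fun n => image (B n)))
  as (s & _ & Hs).
- easy.
- intros n; destruct (HB n) as [oB [x Bx]]; split.
  + now apply rel_open_image.
  + exists (el x); now apply image_elt.
- assert (Hs' : forall O, open T O -> O s -> frequently_meets K B (fun g => O (el g))).
  { intros O oO Os N; destruct (Hs O) with (N := N) as (n & Hn & t & (g & -> & Bg) & Og).
    - split; [easy|now exists O].
    - easy.
    - exists n; split; [easy|now exists g]. }
  destruct (classic (Hset i a a s)) as [[p ->]|ns].
  + left; exists p; intros Q (O & oO & HO) Qp N.
    destruct (Hs' O oO) with (N := N) as (n & Hn & g & Bg & Og); [now apply HO|].
    exists n; split; [easy|]; exists g; split; [easy|now apply HO].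
  + right; intros W (O & oO & O0 & HO) N.
    destruct (Bsum_cases s) as [->|(j & c & h & d & ->)].
    * destruct (Hs' O oO O0 N) as (n & Hn & g & Bg & Og).
      exists n; split; [easy|]; exists g; split; [easy|now apply HO].
    * destruct (Hs' (Hset j c d) (open_Hset j c d)) with (N := 0) as (n & _ & g & _ & Hg);
        [now exists h|].
      destruct ns; apply Hset_index; apply Hset_index in Hg; simpl in *; congruence.
Qed.

(** [A] is left general to serve both the subgroup and the subgroup with zero adjoined. *)
Lemma jointly_cont_square_root (A : S -> Prop) :
  (forall s, Hset i a a s -> A s) -> jointly_cont_sub T (@bmul I L G) A ->
  square_root_nbhds K trace_open.
Proof.
intros HA [_ Hj] U oU U1.
assert (A1 : A (el (gone K))) by (apply HA; now exists (gone K)).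
destruct (Hj _ _ A1 A1 (image U)) as (P & Q & oP & oQ & P1 & Q1 & PQ).
- now apply rel_open_image.
- rewrite bmul_elt, gone_l; now apply image_elt.
- exists (fun g => P (el g) /\ Q (el g)); split; [|split; [easy|]].
  + apply trace_open_inter; now apply (rel_open_trace A).
  + intros x y [Px _] [_ Qy]; apply image_elt; rewrite <- (bmul_elt i a a a); now apply PQ.
Qed.

Lemma jointly_cont_zero :
  jointly_cont_sub T (@bmul I L G) (fun s => Hset i a a s \/ s = None) ->
  forall W, zero_trace W ->
    exists V, zero_trace V /\ forall x y, V x -> V y -> W (gmul K x y).
Proof.
intros [_ Hj] W (O & oO & O0 & HO).
destruct (Hj None None (or_intror eq_refl) (or_intror eq_refl)
            (fun s => (Hset i a a s \/ s = None) /\ O s))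
  as (P & Q & [_ (P' & oP & HP)] & [_ (Q' & oQ & HQ)] & P0 & Q0 & PQ).
- now apply open_rel_open.
- split; [now right|easy].
- exists (fun g => P' (el g) /\ Q' (el g)); split.
  + exists (fun s => P' s /\ Q' s); split; [now apply open_inter|split; [|easy]].
    split; [apply HP|apply HQ]; auto.
  + intros x y [Px _] [_ Qy]; apply HO; rewrite <- (bmul_elt i a a a).
    apply PQ; [apply HP|apply HQ]; try easy; left; now eexists.
Qed.

(** Were zero adherent to the subgroup, all its traces would be non-empty, and each of the four
    conditions would contradict one of the exclusion results for groups. *)
Lemma zero_isolated_from_subgroup :
  pseudocompact_sub T (fun _ => True) ->
  left_precompact_sub T (@bmul I L G) (@Hset I L G i a a) (el (gone K))
  \/ (pseudocompact_sub T (@Hset I L G i a a) /\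
      jointly_cont_sub T (@bmul I L G) (@Hset I L G i a a))
  \/ (left_omega_precompact_sub T (@bmul I L G) (@Hset I L G i a a) (el (gone K)) /\
      pseudocompact_sub T (@Hset I L G i a a))
  \/ jointly_cont_sub T (@bmul I L G) (fun s => Hset i a a s \/ s = None) ->
  zero_isolated_from (Hset i a a).
Proof.
intros Hpc Hcond; apply NNPP; intros Hni.
pose proof (zero_trace_nonempty Hni) as Hne.
destruct Hcond as [Hlp|[[HpcH Hj]|[[Hlo HpcH]|Hj]]].
- apply (not_left_precompact K trace_open zero_trace zero_trace_full zero_trace_inter
           zero_trace_mull Hne zero_trace_separated).
  intros U oU U1; destruct (Hlp (image U) (nbhd_image U oU U1)) as (l & Hl & HU).
  destruct (Hset_list i a a l Hl) as [l' ->]; exists l'; intros x.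
  destruct (HU (el x)) as (s & t & Hs & (u & -> & Uu) & E); [now exists x|].
  apply in_map_iff in Hs as (f & <- & Hf).
  rewrite bmul_elt in E; apply elt_inj in E; now exists f, u.
- apply (not_jointly_continuous_feebly_compact K trace_open trace_open_inter trace_open_mull
           trace_open_mulr zero_trace zero_trace_open zero_trace_full zero_trace_inter
           zero_trace_mulr Hne zero_trace_separated).
  + now apply (jointly_cont_square_root (Hset i a a)).
  + intros B HB; left; now apply pseudocompact_trace_clusters.
- apply (not_left_omega_precompact_feebly_compact K trace_open trace_open_mull zero_trace
           zero_trace_open zero_trace_full zero_trace_inter zero_trace_mull Hne
           zero_trace_separated).
  + intros B HB; now apply pseudocompact_trace_clusters.
  + intros U oU U1; destruct (Hlo (image U) (nbhd_image U oU U1)) as (f & Hf & HU).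
    destruct (functional_choice (fun n g => f n = el g) Hf) as [h Hh]; exists h; intros x.
    destruct (HU (el x)) as (n & t & (u & -> & Uu) & E); [now exists x|].
    rewrite Hh, bmul_elt in E; apply elt_inj in E; now exists n, u.
- apply (not_jointly_continuous_feebly_compact K trace_open trace_open_inter trace_open_mull
           trace_open_mulr zero_trace zero_trace_open zero_trace_full zero_trace_inter
           zero_trace_mulr Hne zero_trace_separated).
  + apply (jointly_cont_square_root (fun s => Hset i a a s \/ s = None)); [now left|easy].
  + intros B HB; destruct (pseudocompact_clusters_or_zero B Hpc HB); [now left|right].
    split; [now apply jointly_cont_zero|easy].
Qed.

End Trace.
End Continuity.
End BrandtSum.

Theorem theorem2p12 (I : Type) (L : I -> Type) (G : I -> Grp)
  (T : topology (Bsum L G))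
  (HS : semitop_semigroup T (@bmul I L G))
  (Hpc : pseudocompact_sub T (fun _ => True))
  (alpha : forall i, L i)
  (Hcond : forall i,
     left_precompact_sub T (@bmul I L G) (@Hset I L G i (alpha i) (alpha i))
                         (@elt I L G i (alpha i) (gone (G i)) (alpha i))
     \/ (pseudocompact_sub T (@Hset I L G i (alpha i) (alpha i)) /\
         jointly_cont_sub T (@bmul I L G) (@Hset I L G i (alpha i) (alpha i)))
     \/ (left_omega_precompact_sub T (@bmul I L G) (@Hset I L G i (alpha i) (alpha i))
                         (@elt I L G i (alpha i) (gone (G i)) (alpha i)) /\
         pseudocompact_sub T (@Hset I L G i (alpha i) (alpha i)))
     \/ jointly_cont_sub T (@bmul I L G)
           (fun s => Hset i (alpha i) (alpha i) s \/ s = None)) :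
  (* (i) *)
  (forall i (a : L i),
     clopen T (@Hset I L G i a a) /\ pseudocompact_sub T (@Hset I L G i a a)) /\
  (* (ii) *)
  (forall i,
     pseudocompact_sub T (@Bset I L G i) /\
     (forall a b c d : L i, homeomorphic_sub T (@Hset I L G i a b) (@Hset I L G i c d)) /\
     (forall a b : L i, top_iso_sub T (@bmul I L G) (@Hset I L G i a a) (@Hset I L G i b b)) /\
     (forall a : L i, pseudocompact_sub T (@Hset I L G i a a) /\
                      semitop_sub T (@bmul I L G) (@Hset I L G i a a))) /\
  (* (iii) *)
  (forall i (Bf : (Bsum L G -> Prop) -> Prop),
     base_at T Bf (@elt I L G i (alpha i) (gone (G i)) (alpha i)) ->
     (forall U, Bf U -> forall s, U s -> Hset i (alpha i) (alpha i) s) ->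
     forall (b c : L i) (x : G i),
       base_at T
         (fun V => exists U, Bf U /\
            forall s, V s <-> setmul3 (@elt I L G i b x (alpha i)) U
                                      (@elt I L G i (alpha i) (gone (G i)) c) s)
         (@elt I L G i b x c)) /\
  (* (iv) *)
  (semiregular T -> base_at T (@zero_family I L G) None).
Proof.
(* The condition at the single index [alpha i] suffices: translations carry the isolation of zero to
   every cell with the same [i]. *)
assert (Hcl : forall i (a b : L i), clopen T (@Hset I L G i a b)).
{ intros i a b; apply clopen_Hset; [easy|].
  apply zero_isolated_translate with (alpha i) (alpha i); [easy|].
  now apply zero_isolated_from_subgroup. }
assert (HpcH : forall i (a : L i), pseudocompact_sub T (@Hset I L G i a a)).
{ intros i a; apply pseudocompact_clopen; [easy|easy|].
  now exists (elt i a (gone (G i)) a), (gone (G i)). }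
split; [|split; [|split]].
- intros i a; now split.
- intros i; split; [|split; [|split]].
  + now apply pseudocompact_Bset.
  + intros a b c d; now apply homeomorphic_Hset.
  + intros a b; now apply top_iso_Hset.
  + intros a; split; [easy|now apply semitop_Hset].
- intros i Bf HB Hsub b c x; now apply base_at_translate.
- now apply zero_family_base.
Qed.
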